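(* For every Noetherian space $X$, letting $\alpha = ||X||$, the stature $||X^*||$ is equal to $1$ if $\alpha = 0$, and to $\omega^{\omega^{\alpha'}}$ otherwise, where $\alpha' = \alpha - 1$ if $\alpha$ is finite and non-zero, $\alpha' = \alpha + 1$ if $\alpha = \epsilon + n$ for some critical ordinal $\epsilon$ and some natural number $n$, and $\alpha' = \alpha$ otherwise.
   Context: A topological space is Noetherian if every open subset is compact (every open cover has a finite subcover; no separation is required). For a well-founded poset $P$ and $x \in P$, $\mathrm{rk}_P(x) = \sup_{x' < x} (\mathrm{rk}_P(x')+1)$ and the ordinal rank of $P$ is $|P| = \sup_{x \in P} (\mathrm{rk}_P(x)+1)$, where $\sup\emptyset = 0$. $\mathcal{H}_0 X$ is the poset of all closed subsets of $X$ (including $\emptyset$), ordered by inclusion; it is well-founded when $X$ is Noetherian. The stature of a Noetherian space $X$ is $||X|| = |\mathcal{H}_0 X| - 1$, equivalently $||X|| = \mathrm{rk}_{\mathcal{H}_0 X}(X)$. $X^*$ is the set of finite words over $X$ (including the empty word) with the word topology: the topology generated by the subsets $X^* U_1 X^* U_2 X^* \cdots X^* U_n X^*$ (concatenation of sets of words), where $n \in \mathbb{N}$ and $U_1, \ldots, U_n$ are open subsets of $X$. $X^*$ is Noetherian when $X$ is. A critical ordinal is an ordinal $\epsilon$ such that $\epsilon = \omega^\epsilon$ (ordinal exponentiation). *)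

(* Defs.v *)
From HB Require Import structures.
From mathcomp Require Import all_boot.
From mathcomp Require Import boolp classical_sets topology.

Set Implicit Arguments.
Unset Strict Implicit.
Unset Printing Implicit Defensive.

Local Open Scope classical_set_scope.

(** * Ordinals

    [osup A f] is the ordinal [sup_i (f i + 1)], i.e. the least ordinal strictly
    above every [f i]; every ordinal is of this form.  Distinct trees may denote
    the same ordinal: equality of ordinals is [oeq]. *)
Inductive Ord : Type := osup (A : Type) (f : A -> Ord).

Definition oidx (a : Ord) : Type := let: osup A _ := a in A.

Definition ofam (a : Ord) : oidx a -> Ord :=
  match a return oidx a -> Ord with osup _ f => f end.

Fixpoint ole (a b : Ord) : Prop :=
  let: osup A f := a in forall i : A, exists j : oidx b, ole (f i) (ofam j).

Definition olt (a b : Ord) : Prop := exists j : oidx b, ole a (ofam j).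

Definition oeq (a b : Ord) : Prop := ole a b /\ ole b a.

Definition ozero : Ord := osup (fun x : False => match x with end).

Definition osucc (a : Ord) : Ord := osup (fun _ : unit => a).

Definition onat (n : nat) : Ord := iter n osucc ozero.

Definition omega : Ord := osup onat.

(** The supremum of the [f i], as opposed to that of the [f i + 1]. *)
Definition olub (A : Type) (f : A -> Ord) : Ord :=
  osup (fun p : {i : A & oidx (f i)} => ofam (projT2 p)).

(** [a - 1], for [a] a successor: the supremum of the ordinals below [a] (so
    that [opred a] is [a] when [a] is zero or a limit). *)
Definition opred (a : Ord) : Ord := olub (@ofam a).

(** [a + b] is the least ordinal above every [c < a] and every [a + d], [d < b]. *)
Fixpoint oadd (a b : Ord) : Ord :=
  let: osup J g := b in
  osup (fun k : oidx a + J =>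
          match k with inl i => ofam i | inr j => oadd a (g j) end).

(** [a * b] is the least ordinal above every [a * d + c], [d < b], [c < a]. *)
Fixpoint omul (a b : Ord) : Ord :=
  let: osup J g := b in
  osup (fun k : J * oidx a => oadd (omul a (g k.1)) (ofam k.2)).

(** [omega ^ b] is the supremum of 1 and of the [omega ^ d * omega], [d < b]. *)
Fixpoint omega_exp (b : Ord) : Ord :=
  let: osup J g := b in
  olub (fun k : option J =>
          if k is Some j then omul (omega_exp (g j)) omega else onat 1).

Definition ofinite (a : Ord) : Prop := exists n : nat, oeq a (onat n).

Definition critical (e : Ord) : Prop := oeq e (omega_exp e).

Lemma ole_refl a : ole a a.
Proof. by elim: a => A f IH /= i; exists i. Qed.

Lemma ole_trans b a c : ole a b -> ole b c -> ole a c.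
Proof.
elim: a b c => A f IH [B g] [C h] /= ab bc i.
by have [j fg] := ab i; have [k gh] := bc j; exists k; apply: IH fg gh.
Qed.

(** * Ranks in well-founded posets, given by their strict order *)
Section Rank.
Variables (P : Type) (lt : P -> P -> Prop) (wf : well_founded lt).

Definition rk : P -> Ord :=
  Fix wf (fun=> Ord)
    (fun x rec => osup (fun y : {y | lt y x} => rec (sval y) (svalP y))).

Lemma rkE x : rk x = osup (fun y : {y | lt y x} => rk (sval y)).
Proof.
rewrite /rk Fix_eq // => {}x f g fg; congr osup.
by apply/funext => -[y yx] /=.
Qed.

Definition ordinal_rank : Ord := osup rk.

Lemma rk_le x y : (forall z, lt z x -> lt z y) -> ole (rk x) (rk y).
Proof.
move=> xy; rewrite !rkE /= => -[z zx].
by exists (exist _ z (xy _ zx)); apply: ole_refl.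
Qed.

End Rank.

(** * Noetherian spaces and stature *)
Definition noetherian (X : topologicalType) : Prop :=
  forall U : set X, open U -> cover_compact U.

Definition closed_set (X : topologicalType) : Type := {C : set X | closed C}.

Definition closed_set_lt (X : topologicalType) (C D : closed_set X) : Prop :=
  sval C `<` sval D.

(** The stature is only meaningful when the closed sets are well-founded under
    inclusion, which holds on Noetherian spaces ([noetherian_wf] below); it is set
    to 0 otherwise. *)
Definition stature (X : topologicalType) : Ord :=
  match pselect (well_founded (@closed_set_lt X)) with
  | left wf => opred (ordinal_rank wf)
  | right _ => ozero
  end.

Definition whole (X : topologicalType) : closed_set X :=
  exist _ setT (@closedT X).

Lemma stature_rk (X : topologicalType) (wf : well_founded (@closed_set_lt X)) :
  oeq (stature X) (rk wf (whole X)).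
Proof.
rewrite /stature; case: pselect => // wf'.
rewrite (Prop_irrelevance wf' wf); split=> /=; last first.
  rewrite {1}rkE /= => -[y yX].
  have e : rk wf (whole X) = osup (fun z : {z | closed_set_lt z (whole X)} =>
    rk wf (sval z)) by rewrite rkE.
  have [k hk] : exists k : oidx (rk wf (whole X)), ole (rk wf y) (ofam k).
    by rewrite e /=; exists (exist _ y yX); apply: ole_refl.
  by exists (existT (fun C => oidx (rk wf C)) (whole X) k).
case=> C k /=.
have : ole (rk wf C) (rk wf (whole X)).
  apply: rk_le => D [DC CD]; split=> //= TD.
  by apply: CD => x _; apply: TD.
by move: k; case: (rk wf C) => A f i /(_ i).
Qed.

Lemma noetherian_wf (X : topologicalType) :
  noetherian X -> well_founded (@closed_set_lt X).
Proof.
move=> noX C; apply: contrapT => nC.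
have /choice[next nextP] : forall D : closed_set X, exists E,
    ~ Acc (@closed_set_lt X) D ->
    closed_set_lt E D /\ ~ Acc (@closed_set_lt X) E.
  move=> D; apply: contrapT => /forallNP nE; have /not_implyP[nD _] := nE D.
  apply: nD; constructor=> E ED; apply: contrapT => nAE.
  by have := nE E; apply=> _; split.
pose s n := iter n next C.
have ns n : ~ Acc (@closed_set_lt X) (s n).
  by elim: n => //= n /nextP[].
have sS n : closed_set_lt (s n.+1) (s n) by have [] := nextP _ (ns n).
have sle m n : m <= n -> sval (s n) `<=` sval (s m).
  elim: n => [|n IH]; first by rewrite leqn0 => /eqP->.
  rewrite leq_eqVlt => /orP[/eqP->//|]; rewrite ltnS => /IH.
  by apply: subset_trans; have [] := sS n.
pose f n := ~` sval (s n).
have fo n : open (f n) by apply: closed_openC; apply: svalP.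
have fU : open (\bigcup_n f n) by apply: bigcup_open => n _; apply: fo.
have [D' _ D'P] := noX _ fU nat setT f (fun n _ => fo n) (fun x Ux => Ux).
pose m := \max_(i <- finmap.enum_fset D') i.
have [_] := sS m; apply => x sx; apply: contrapT => nsx.
have [|i /= iD'] := D'P x; first by exists m.+1.
by apply; apply: sle sx; rewrite /m; apply: (@leq_bigmax_seq _ _ xpredT id).
Qed.

(** * Finite words *)
Definition words (X : Type) : Type := seq X.

Definition lcat (X : Type) (L M : set (words X)) : set (words X) :=
  [set u ++ v | u in L & v in M].

Definition letters (X : Type) (U : set X) : set (words X) :=
  [set [:: x] | x in U].

(** [X^* U_1 X^* U_2 X^* ... X^* U_n X^*] for [Us = [:: U_1; ...; U_n]]. *)
Definition word_open (X : Type) (Us : seq (set X)) : set (words X) :=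
  foldr (fun U L => lcat setT (lcat (letters U) L)) setT Us.

Section WordTopology.
Variable X : topologicalType.

HB.instance Definition _ := Choice.on (words X).

HB.instance Definition _ := @isSubBaseTopological.Build (words X)
  (set (words X))
  [set word_open Us | Us in [set Us : seq (set X) | {in Us, forall U, open U}]]
  id.

End WordTopology.

(** [word_exponent (||X||)] is the [alpha'] such that [||X^*||] is
    [omega ^ (omega ^ alpha')] for [X] nonempty. *)
Definition word_exponent (a : Ord) : Ord :=
  if `[< ofinite a /\ ~ oeq a ozero >] then opred a
  else if `[< exists (e : Ord) (n : nat), critical e /\ oeq a (oadd e (onat n)) >]
  then osucc a
  else a.

(* Main.v *)
Require Import Defs.
From mathcomp Require Import all_boot.
From mathcomp Require Import boolp classical_sets topology.
From mathcomp Require Import zify.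

Set Implicit Arguments.
Unset Strict Implicit.
Unset Printing Implicit Defensive.

Local Open Scope classical_set_scope.

(** The stature of a Noetherian space is the least ordinal [a] such that each
    proper closed subset has stature below [a].  This makes sense for arbitrary
    subsets of a space, with their subspace topology, and the proof bounds the
    stature of the set [star F] of words over [F] from both sides, by induction on
    the stature [a] of [F].  Write [a'] for [word_exponent a].

    Upper bound.  A proper closed subset of [star F] avoids some
    [X^* U_1 X^* ... U_n X^*] with every [U_i] meeting [F].  Cutting words at their
    first letter in [U_1], then in [U_2], and so on, it is contained in a
    concatenation of the sets [star (F `\` U_i)], small by induction since
    [F `\` U_i] is a proper closed subset of [F], and of sets of words of length at
    most one ([stat_lt_avoid]).  It remains to see that the subsets of stature below
    [omega ^ omega ^ a'] are closed under finite unions and concatenations.  Unions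
    are bounded by natural sums ([stat_leU]).  For concatenations,
    [stat_le_lcat] shows that statures [omega ^ c] and [omega ^ d] combine to at most
    [omega ^ (c (+) d)], where [(+)] is the natural sum; this relies on cutting a
    space along a Cantor normal form of its stature ([stat_le_split]).  The
    induction closes because [a'] is strictly increasing in [a] and
    [a < omega ^ omega ^ a'].

    Lower bound.  If [C] is a proper closed subset of [F] of stature [b] and [x] is
    in [F] but not in [C], the words [u_1 x u_2 x ... u_n x] with [u_i] over [C]
    behave like an [n]-fold product of the space of words over [C], and the stature
    of a product is at least the product of the statures ([stat_ge_mul]).  As [n]
    grows this raises [omega ^ omega ^ b'] to [omega ^ omega ^ (b' + 1)].  Taking the
    supremum over [b < a] yields [omega ^ omega ^ a'], except at critical [a], where
    it would only give [omega ^ omega ^ a = a]; there the words of length [n]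
    already have stature at least [a ^ n], whose supremum is
    [omega ^ omega ^ (a + 1)]. *)

(** * The order on ordinals *)

Lemma oleP a b : ole a b <-> forall i, olt (@ofam a i) b.
Proof. by case: a. Qed.

Lemma ofam_le a (i : oidx a) : ole (ofam i) a.
Proof.
elim: a i => A f IH /= i; apply/oleP => k.
by exists i; apply: IH.
Qed.

Lemma ofam_lt a (i : oidx a) : olt (ofam i) a.
Proof. by exists i; apply: ole_refl. Qed.

Lemma oltW a b : olt a b -> ole a b.
Proof. by move=> [j ab]; apply: ole_trans ab (ofam_le j). Qed.

Lemma ole_lt_trans b a c : ole a b -> olt b c -> olt a c.
Proof. by move=> ab [j bc]; exists j; apply: ole_trans bc. Qed.

Lemma olt_le_trans b a c : olt a b -> ole b c -> olt a c.
Proof. by move=> [j ab] /oleP /(_ j) [k bc]; exists k; apply: ole_trans bc. Qed.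

Lemma olt_trans b a c : olt a b -> olt b c -> olt a c.
Proof. by move=> ab /oltW; apply: olt_le_trans. Qed.

Lemma olt_irr a : ~ olt a a.
Proof.
elim: a => A f IH [j fj]; apply: (IH j).
by apply: olt_le_trans fj; apply: (@ofam_lt (osup f)).
Qed.

Lemma olt_ind (P : Ord -> Prop) :
  (forall a, (forall b, olt b a -> P b) -> P a) -> forall a, P a.
Proof.
move=> IH a; suff : forall b, ole b a -> P b by apply; apply: ole_refl.
elim: a => A f IHf b ba; apply: IH => c cb.
by have [i ci] := olt_le_trans cb ba; apply: IHf ci.
Qed.

(** Classical: if some [f i < osup f] is not below [b], then by induction it lies
    above every element of the family of [b]. *)
Lemma ole_or_lt a b : ole a b \/ olt b a.
Proof.
elim: a b => A f IH b; case: (pselect (ole (osup f) b)) => [|nab]; first by left.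
right; have /existsNP[i nfi] : ~ forall i, olt (f i) b by [].
exists i => /=; apply/oleP => j; have [fj|//] := IH i (ofam j).
by case: nfi; exists j.
Qed.

Lemma olt_or_le a b : olt a b \/ ole b a.
Proof. by have [|] := ole_or_lt b a; [right|left]. Qed.

Lemma ozero_le a : ole ozero a.
Proof. by apply/oleP. Qed.

Lemma ole0 a : ole a ozero -> forall i : oidx a, False.
Proof. by move=> /oleP a0 i; case: (a0 i). Qed.

Lemma olt_osucc a b : olt a (osucc b) <-> ole a b.
Proof. by split=> [[[]]//|ab]; exists tt. Qed.

Lemma osucc_le a b : ole (osucc a) b <-> olt a b.
Proof. by rewrite oleP; split=> [/(_ tt)|ab []]. Qed.

Lemma olubP A (f : A -> Ord) b : ole (olub f) b <-> forall i, ole (f i) b.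
Proof.
split=> [/oleP ub i|ub]; last first.
  by apply/oleP => -[i k] /=; apply: olt_le_trans (ub i); apply: ofam_lt.
by apply/oleP => k; apply: (ub (existT _ i k)).
Qed.

Lemma olub_ge A (f : A -> Ord) i : ole (f i) (olub f).
Proof. by have /olubP := ole_refl (olub f). Qed.

Lemma olt_olub A (f : A -> Ord) b : olt b (olub f) -> exists i, olt b (f i).
Proof. by move=> [[i k] /= bk]; exists i; exists k. Qed.

Lemma opred_succ a : oeq (opred (osucc a)) a.
Proof.
split; first by apply/olubP => -[] /=; apply: ole_refl.
exact: (@olub_ge _ (@ofam (osucc a)) tt).
Qed.

Lemma opred_mono a b : ole a b -> ole (opred a) (opred b).
Proof.
move=> /oleP ab; apply/olubP => i; have [j ij] := ab i.
exact: ole_trans ij (olub_ge _ j).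
Qed.

Lemma oeq_sym a b : oeq a b -> oeq b a. Proof. by case. Qed.

Lemma oeq_trans b a c : oeq a b -> oeq b c -> oeq a c.
Proof. by move=> [ab ba] [bc cb]; split; [apply: ole_trans bc|apply: ole_trans ba]. Qed.

Lemma onat_lt m n : m < n -> olt (onat m) (onat n).
Proof.
elim: n => // n IH; rewrite ltnS leq_eqVlt => /orP[/eqP->|/IH mn].
  exact/olt_osucc/ole_refl.
exact/olt_osucc/oltW.
Qed.

Lemma onat_le m n : m <= n -> ole (onat m) (onat n).
Proof. by move=> mn; apply/olt_osucc; apply: (@onat_lt m n.+1). Qed.

Lemma olt_onat a n : olt a (onat n) -> exists2 m, m < n & oeq a (onat m).
Proof.
elim: n => [[[]]|n IH /olt_osucc an].
have [/IH[m mn am]|na] := olt_or_le a (onat n); first by exists m => //; apply: ltnW.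
by exists n.
Qed.

Lemma ole_lt_osucc a b : ole a b -> ole (osucc a) (osucc b).
Proof. by move=> ab; apply/osucc_le/olt_osucc. Qed.

(** * Sums and products *)

Lemma olt_oadd a b x :
  olt x (oadd a b) <-> olt x a \/ exists j : oidx b, ole x (oadd a (ofam j)).
Proof.
case: b => J g; split=> [[[i|j] /= xk]|[[i xi]|[j xj]]].
- by left; exists i.
- by right; exists j.
- by exists (inl i).
- by exists (inr j).
Qed.

Lemma ole_oaddP a b c :
  ole (oadd a b) c <-> ole a c /\ forall j : oidx b, olt (oadd a (ofam j)) c.
Proof.
split=> [abc|[ac bc]].
  split=> [|j]; last by apply: olt_le_trans abc; apply/olt_oadd; right; exists j; apply: ole_refl.
  by apply/oleP => i; apply: olt_le_trans abc; apply/olt_oadd; left; apply: ofam_lt.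
apply/oleP => k; have /olt_oadd[ka|[j kj]] := ofam_lt k; first exact: olt_le_trans ac.
exact: ole_lt_trans (bc j).
Qed.

Lemma oadd_mono a a' b b' : ole a a' -> ole b b' -> ole (oadd a b) (oadd a' b').
Proof.
move=> aa'; elim: b b' => J g IH b' /oleP bb'; apply/ole_oaddP; split=> [|j].
  apply/oleP => i; apply/olt_oadd; left; exact: olt_le_trans (ofam_lt i) aa'.
have [k jk] := bb' j; apply/olt_oadd; right; exists k; exact: IH.
Qed.

Lemma ole_oaddr a b : ole a (oadd a b).
Proof. by have /ole_oaddP[] := ole_refl (oadd a b). Qed.

Lemma oadd_lt a b b' : olt b b' -> olt (oadd a b) (oadd a b').
Proof.
move=> [j bj]; apply/olt_oadd; right; exists j.
by apply: oadd_mono bj; apply: ole_refl.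
Qed.

Lemma ole_oaddl a b : ole b (oadd a b).
Proof.
elim: b => J g IH; apply/oleP => j; apply/olt_oadd; right; exists j; exact: IH.
Qed.

Lemma oadd0 a : oeq (oadd a ozero) a.
Proof.
by split; [apply/ole_oaddP; split=> [|[]]; apply: ole_refl|apply: ole_oaddr].
Qed.

Lemma oaddA a b c : oeq (oadd (oadd a b) c) (oadd a (oadd b c)).
Proof.
elim: c => J g IH; split.
  apply/ole_oaddP; split=> [|j].
    by apply: oadd_mono; [apply: ole_refl|apply: ole_oaddr].
  apply: ole_lt_trans (IH j).1 _; apply: oadd_lt; apply: oadd_lt.
  exact: (@ofam_lt (osup g)).
apply/ole_oaddP; split=> [|k].
  exact: ole_trans (ole_oaddr a b) (ole_oaddr _ _).
have /olt_oadd[kb|[j kj]] := ofam_lt k.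
  by apply: olt_le_trans (oadd_lt _ kb) (ole_oaddr _ _).
apply/olt_oadd; right; exists j; apply: ole_trans (IH j).2.
by apply: oadd_mono kj; apply: ole_refl.
Qed.

Lemma oadd_onatS a n : oeq (oadd a (onat n.+1)) (osucc (oadd a (onat n))).
Proof.
split.
  apply/ole_oaddP; split=> [|[]]; last exact/olt_osucc/ole_refl.
  exact/oltW/olt_osucc/ole_oaddr.
exact/osucc_le/oadd_lt/ofam_lt.
Qed.

Lemma olt_omul a b x :
  olt x (omul a b) <-> exists (j : oidx b) (i : oidx a),
    ole x (oadd (omul a (ofam j)) (ofam i)).
Proof.
by case: b => J g; split=> [[[j i] /= xk]|[j [i xk]]]; [exists j, i|exists (j, i)].
Qed.

Lemma ole_omulP a b c : ole (omul a b) c <->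
  forall (j : oidx b) (i : oidx a), olt (oadd (omul a (ofam j)) (ofam i)) c.
Proof.
split=> [abc j i|abc].
  by apply: olt_le_trans abc; apply/olt_omul; exists j, i; apply: ole_refl.
apply/oleP => k; have /olt_omul[j [i kji]] := ofam_lt k.
exact: ole_lt_trans (abc j i).
Qed.

Lemma omul_mono a a' b b' : ole a a' -> ole b b' -> ole (omul a b) (omul a' b').
Proof.
move=> aa'; elim: b b' => J g IH b' /oleP bb'; apply/ole_omulP => j i.
have [k jk] := bb' j; have [l il] : olt (ofam i) a' by apply: olt_le_trans aa'; apply: ofam_lt.
by apply/olt_omul; exists k, l; apply: oadd_mono il; apply: IH.
Qed.

Lemma olt_omulr a b b' r : olt b b' -> olt r a -> olt (oadd (omul a b) r) (omul a b').
Proof.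
move=> [j bj] [i ri]; apply/olt_omul; exists j, i.
by apply: oadd_mono ri; apply: omul_mono bj; apply: ole_refl.
Qed.

Lemma omul_osucc a b : oeq (omul a (osucc b)) (oadd (omul a b) a).
Proof.
split; first by apply/ole_omulP => -[] i; apply/oadd_lt/ofam_lt.
apply/ole_oaddP; split=> [|i]; last exact/olt_omulr/ofam_lt/ofam_lt.
apply: omul_mono; [exact: ole_refl|exact/oltW/ofam_lt].
Qed.

Lemma omul1 a : oeq (omul a (onat 1)) a.
Proof.
apply: oeq_trans (omul_osucc _ _) _; split; last exact: ole_oaddl.
elim: a {-2}a (ole_refl a) => A f IH a aA; apply/ole_oaddP; split=> [|i].
  by apply/ole_omulP => -[].
have [k ik] : olt (ofam i) (osup f) by apply: olt_le_trans aA; apply: ofam_lt.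
have ei : ole (oadd (omul a ozero) (ofam i)) (ofam i).
  apply: ole_trans (IH k _ ik); apply: oadd_mono; last exact: ole_refl.
  by apply/ole_omulP => -[].
exact: ole_lt_trans ei (ofam_lt i).
Qed.

Lemma omul_oadd a b c : oeq (omul a (oadd b c)) (oadd (omul a b) (omul a c)).
Proof.
elim: c => J g IH; split.
  apply/ole_omulP => k i; have /olt_oadd[kb|[j kj]] := ofam_lt k.
    by apply: olt_le_trans (ole_oaddr _ _); apply: olt_omulr; last exact: ofam_lt.
  apply: (@ole_lt_trans (oadd (oadd (omul a b) (omul a (g j))) (ofam i))).
    apply: oadd_mono (ole_refl _); apply: ole_trans (IH j).1.
    by apply: omul_mono kj; apply: ole_refl.
  apply: ole_lt_trans (oaddA _ _ _).1 _; apply: oadd_lt.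
  by apply: olt_omulr (ofam_lt i); apply: (@ofam_lt (osup g)).
apply/ole_oaddP; split=> [|k].
  by apply: omul_mono; [apply: ole_refl|apply: ole_oaddr].
have /olt_omul[j [i kji]] := ofam_lt k.
apply: (@ole_lt_trans (oadd (omul a (oadd b (g j))) (ofam i))).
  apply: ole_trans (oadd_mono (IH j).2 (ole_refl _)).
  by apply: ole_trans (oaddA _ _ _).2; apply: oadd_mono kji; apply: ole_refl.
by apply: olt_omulr (ofam_lt i); apply: oadd_lt; apply: (@ofam_lt (osup g)).
Qed.

Lemma omulA a b c : ole (omul (omul a b) c) (omul a (omul b c)).
Proof.
elim: c => J g IH; apply/ole_omulP => j k.
have /olt_omul[l [i kli]] := ofam_lt k.
apply: (@ole_lt_trans (oadd (omul a (oadd (omul b (g j)) (ofam l))) (ofam i))).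
  apply: ole_trans (oadd_mono (omul_oadd _ _ _).2 (ole_refl _)).
  apply: ole_trans (oaddA _ _ _).2; apply: oadd_mono kli; exact: IH.
apply: olt_omulr (ofam_lt i); apply: olt_omulr (ofam_lt l).
exact: (@ofam_lt (osup g)).
Qed.

Lemma oadd1_onat n : ole (onat n.+1) (oadd (onat 1) (onat n)).
Proof.
elim: n => [|n IH]; first exact: ole_oaddr.
exact: ole_trans (ole_lt_osucc IH) (oadd_onatS _ _).2.
Qed.

(** [omul c (onat n.+1)] unfolds to [c * n + c]; here the new factor is on the
    left, where the product of subspaces puts it. *)
Lemma omul_onatS_le c n : ole (omul c (onat n.+1)) (oadd c (omul c (onat n))).
Proof.
apply: ole_trans (omul_mono (ole_refl c) (oadd1_onat n)) _.
apply: ole_trans (omul_oadd _ _ _).1 _.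
exact: oadd_mono (omul1 c).1 (ole_refl _).
Qed.

Lemma omul_le_onat a n : ole a (onat 1) -> ole (omul a (onat n)) (onat n).
Proof.
move=> a1; elim: n => [|n IH]; first by apply/ole_omulP => -[].
apply: ole_trans (omul_osucc _ (onat n)).1 _; apply: ole_trans (oadd_mono IH a1) _.
apply: ole_trans (oadd_onatS _ 0).1 _; exact/ole_lt_osucc/(oadd0 _).1.
Qed.

Lemma onat_omega n : olt (onat n) omega.
Proof. by exists n; apply: ole_refl. Qed.

(** * Powers of omega *)

Lemma omega_expE b c : ole (omega_exp b) c <->
  ole (onat 1) c /\ forall j : oidx b, ole (omul (omega_exp (ofam j)) omega) c.
Proof.
case: b => J g; split=> [/olubP bc|[c1 bc]].
  by split=> [|j]; [apply: (bc None)|apply: (bc (Some j))].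
by apply/olubP => -[j|] //; apply: bc.
Qed.

Lemma omega_exp_gt0 b : olt ozero (omega_exp b).
Proof. by apply/osucc_le; have /omega_expE[] := ole_refl (omega_exp b). Qed.

Lemma omega_exp_mono a b : ole a b -> ole (omega_exp a) (omega_exp b).
Proof.
elim: a b => A f IH b /oleP ab; apply/omega_expE; split=> [|i].
  exact/osucc_le/omega_exp_gt0.
have [j ij] := ab i; have /omega_expE[_ /(_ j)] := ole_refl (omega_exp b).
by apply: ole_trans; apply: omul_mono (ole_refl _); apply: IH.
Qed.

Lemma omul_omega_exp_le a b : olt a b -> ole (omul (omega_exp a) omega) (omega_exp b).
Proof.
move=> [j aj]; have /omega_expE[_ /(_ j)] := ole_refl (omega_exp b).
by apply: ole_trans; apply: omul_mono (ole_refl _); apply: omega_exp_mono.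
Qed.

Lemma omul_onat_lt a b n : olt a b -> olt (omul (omega_exp a) (onat n)) (omega_exp b).
Proof.
move=> ab; apply: olt_le_trans (omul_omega_exp_le ab).
apply: ole_lt_trans (ole_oaddr _ ozero) _.
exact/olt_omulr/omega_exp_gt0/onat_omega.
Qed.

Lemma omega_exp_lt a b : olt a b -> olt (omega_exp a) (omega_exp b).
Proof.
by move=> /(omul_onat_lt 1); apply: ole_lt_trans (omul1 _).2.
Qed.

Lemma omega_exp_ge a : ole a (omega_exp a).
Proof.
elim: a => A f IH; apply/oleP => i; apply: ole_lt_trans (IH i) _.
exact/omega_exp_lt/(@ofam_lt (osup f)).
Qed.

(** The leading term of the Cantor normal form of [x], rounded up. *)
Lemma olt_omega_exp x c : olt x (omega_exp c) ->
  ole x ozero \/ exists (j : oidx c) n, ole x (omul (omega_exp (ofam j)) (onat n)).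
Proof.
case: c => J g /olt_olub[[j|] xk]; last by left; apply/olt_osucc.
right; exists j; have /olt_omul[n [i xn]] := xk; exists n.+1.
by apply/oltW; apply: ole_lt_trans xn _; apply: olt_omulr (ofam_lt i); apply: (@onat_lt n n.+1).
Qed.

(** Exponents add up: this turns lower bounds that multiply under concatenation
    into linear growth of the exponent. *)
Lemma omega_exp_oadd a b :
  ole (omega_exp (oadd a b)) (omul (omega_exp a) (omega_exp b)).
Proof.
elim: b => J g IH; apply/omega_expE; split=> [|k].
  apply/osucc_le/(ole_lt_trans (ozero_le (oadd (omul (omega_exp a) ozero) ozero))).
  exact/olt_omulr/omega_exp_gt0/omega_exp_gt0.
have /olt_oadd[ka|[j kj]] := ofam_lt k.
  apply: ole_trans (omul_omega_exp_le ka) _; apply: ole_trans (omul1 _).2 _.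
  by apply: omul_mono; [apply: ole_refl|apply/osucc_le/omega_exp_gt0].
apply: (@ole_trans (omul (omul (omega_exp a) (omega_exp (g j))) omega)).
  apply: omul_mono (ole_refl _); apply: ole_trans (IH j).
  exact: omega_exp_mono.
apply: ole_trans (omulA _ _ _) _; apply: omul_mono; first exact: ole_refl.
exact/omul_omega_exp_le/(@ofam_lt (osup g)).
Qed.

(** * Natural sums *)

(** The Hessenberg sum [a (+) b], bounding the stature of a union: a proper closed
    subset of [Y `|` Z] is already proper on [Y] or on [Z]. *)
Fixpoint onadd (a : Ord) : Ord -> Ord :=
  let: osup A f := a in
  fix onadd_a (b : Ord) : Ord :=
    let: osup B g := b in
    osup (fun k : A + B =>
            match k with inl i => onadd (f i) b | inr j => onadd_a (g j) end).

Lemma olt_onadd a b x : olt x (onadd a b) <->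
  (exists i : oidx a, ole x (onadd (ofam i) b)) \/
  (exists j : oidx b, ole x (onadd a (ofam j))).
Proof.
case: a b => A f [B g]; split=> [[[i|j] xk]|[[i xi]|[j xj]]].
- by left; exists i.
- by right; exists j.
- by exists (inl i).
- by exists (inr j).
Qed.

Lemma ole_onaddP a b c : ole (onadd a b) c <->
  (forall i : oidx a, olt (onadd (ofam i) b) c) /\
  (forall j : oidx b, olt (onadd a (ofam j)) c).
Proof.
split=> [abc|[ac bc]].
  split=> [i|j]; apply: olt_le_trans abc; apply/olt_onadd; [left; exists i|right; exists j];
    exact: ole_refl.
apply/oleP => k; have /olt_onadd[[i ki]|[j kj]] := ofam_lt k.
  exact: ole_lt_trans (ac i).
exact: ole_lt_trans (bc j).
Qed.

Lemma onadd_mono a a' b b' : ole a a' -> ole b b' -> ole (onadd a b) (onadd a' b').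
Proof.
elim: a a' b b' => A f IHa a' b b' aa'; elim: b b' => B g IHb b' bb'.
apply/ole_onaddP; split=> [i|j]; apply/olt_onadd.
  by move: aa' => /oleP/(_ i)[k ik]; left; exists k; apply: IHa.
by move: bb' => /oleP/(_ j)[k jk]; right; exists k; apply: IHb.
Qed.

Lemma onadd_ltl a a' b : olt a a' -> olt (onadd a b) (onadd a' b).
Proof.
by move=> [i ai]; apply/olt_onadd; left; exists i; apply: onadd_mono ai (ole_refl _).
Qed.

Lemma onadd_ltr a b b' : olt b b' -> olt (onadd a b) (onadd a b').
Proof.
by move=> [i bi]; apply/olt_onadd; right; exists i; apply: onadd_mono (ole_refl _) bi.
Qed.

Lemma onadd0l a : ole (onadd ozero a) a.
Proof.
by elim: a => A f IH; apply/ole_onaddP; split=> [[]|i];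
  apply: ole_lt_trans (IH i) (@ofam_lt (osup f) i).
Qed.

Lemma onadd0r a : ole (onadd a ozero) a.
Proof.
by elim: a => A f IH; apply/ole_onaddP; split=> [i|[]];
  apply: ole_lt_trans (IH i) (@ofam_lt (osup f) i).
Qed.

Definition onadd_closed (e : Ord) : Prop :=
  forall a b, olt a e -> olt b e -> olt (onadd a b) e.

(** Writing [a = e * i + r] and [b = e * j + s] with [r, s < e], the multiples of
    [e] add up and the remainders stay below [e]. *)
Lemma onadd_divmod e (ce : onadd_closed e) i j r s : olt r e -> olt s e ->
  ole (onadd (oadd (omul e (onat i)) r) (oadd (omul e (onat j)) s))
      (oadd (omul e (onat (i + j))) (onadd r s)).
Proof.
have [n] := ubnP (i + j); elim: n i j r s => // n IHn i j.
move=> r s; elim: r s => R f IHr s; elim: s => S g IHs ijn re se.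
have fe k : olt (f k) e by apply: olt_trans re; apply: (@ofam_lt (osup f)).
have ge k : olt (g k) e by apply: olt_trans se; apply: (@ofam_lt (osup g)).
apply/ole_onaddP; split=> k; have := ofam_lt k; move: (ofam k) => {k} x /olt_oadd[xi|[k xk]].
- move: xi; case: i ijn IHr IHs => [|i] ijn IHr IHs /olt_omul[]; first by case.
  move=> [] [k xk].
  apply: (@ole_lt_trans (oadd (omul e (onat (i + j))) (onadd (ofam k) (osup g)))).
    by apply: ole_trans (IHn i j _ _ _ _ _) => //; [apply: onadd_mono (ole_refl _)|apply: ofam_lt].
  apply: olt_le_trans (ole_oaddr _ _); apply: olt_omulr; first exact/onat_lt.
  by apply: ce => //; apply: ofam_lt.
- apply: (@ole_lt_trans (oadd (omul e (onat (i + j))) (onadd (f k) (osup g)))).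
    by apply: ole_trans (IHr k _ _ _ _) => //; apply: onadd_mono (ole_refl _).
  exact/oadd_lt/onadd_ltl/(@ofam_lt (osup f)).
- move: xi; case: j ijn IHr IHs => [|j] ijn IHr IHs /olt_omul[]; first by case.
  move=> [] [k xk].
  apply: (@ole_lt_trans (oadd (omul e (onat (i + j))) (onadd (osup f) (ofam k)))).
    apply: ole_trans (IHn i j _ _ _ _ _) => //;
      [exact: onadd_mono (ole_refl _) xk| |exact: ofam_lt].
    by move: ijn; rewrite addnS.
  apply: olt_le_trans (ole_oaddr _ _); rewrite addnS; apply: olt_omulr; first exact/onat_lt.
  by apply: ce => //; apply: ofam_lt.
- apply: (@ole_lt_trans (oadd (omul e (onat (i + j))) (onadd (osup f) (g k)))).
    by apply: ole_trans (IHs k _ _ _) => //; apply: onadd_mono (ole_refl _) _.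
  exact/oadd_lt/onadd_ltr/(@ofam_lt (osup g)).
Qed.

(** Two ordinals below [omega ^ c] lie below multiples of a common
    [omega ^ d] with [d < c]; by induction [omega ^ d] is closed under natural
    sums, so the multiples add up. *)
Lemma omega_exp_onadd_closed c : onadd_closed (omega_exp c).
Proof.
elim: c => C h IH.
have bound x : olt x (omega_exp (osup h)) ->
    ole x ozero \/ exists k n, ole x (omul (omega_exp (h k)) (onat n)).
  exact: olt_omega_exp.
have hlt k n : olt (omul (omega_exp (h k)) (onat n)) (omega_exp (osup h)).
  exact/omul_onat_lt/(@ofam_lt (osup h)).
have key k n m : olt (onadd (omul (omega_exp (h k)) (onat n)) (omul (omega_exp (h k)) (onat m)))
    (omega_exp (osup h)).
  have e0 := omega_exp_gt0 (h k).
  have := onadd_divmod (IH k) n m e0 e0.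
  move=> /(ole_trans (onadd_mono (ole_oaddr _ _) (ole_oaddr _ _))) le1.
  apply: ole_lt_trans le1 _; apply: ole_lt_trans _ (hlt k (n + m).+1).
  apply: oltW; apply: olt_omulr; first exact: onat_lt.
  by apply: (IH k).
move=> a b ac bc.
have [a0|[k [n an]]] := bound a ac.
  exact: ole_lt_trans (ole_trans (onadd_mono a0 (ole_refl b)) (onadd0l b)) bc.
have [b0|[l [m bm]]] := bound b bc.
  exact: ole_lt_trans (ole_trans (onadd_mono (ole_refl a) b0) (onadd0r a)) ac.
have [kl|/oltW lk] := ole_or_lt (h k) (h l).
  apply: ole_lt_trans (key l n m); apply: onadd_mono bm; apply: ole_trans an _.
  exact: omul_mono (omega_exp_mono kl) (ole_refl _).
apply: ole_lt_trans (key k n m); apply: onadd_mono an _; apply: ole_trans bm _.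
exact: omul_mono (omega_exp_mono lk) (ole_refl _).
Qed.

Lemma onadd_ge a : ole a (onadd a ozero).
Proof.
elim: a => A f IH; apply/oleP => i; apply: ole_lt_trans (IH i) _.
exact/onadd_ltl/(@ofam_lt (osup f)).
Qed.

(** * Critical ordinals and the word exponent *)

Lemma omega_exp_gt1 c : olt ozero c -> olt (onat 1) (omega_exp c).
Proof.
by move=> /omega_exp_lt; apply: ole_lt_trans; apply/osucc_le/omega_exp_gt0.
Qed.

(** Natural sums are strictly increasing, so closure under them yields closure
    under successor. *)
Lemma omega_exp_limit c x : olt ozero c -> olt x (omega_exp c) -> olt (osucc x) (omega_exp c).
Proof.
move=> c0 xc; apply: ole_lt_trans (omega_exp_onadd_closed xc (omega_exp_gt1 c0)).
by apply/osucc_le/(ole_lt_trans (onadd_ge x))/onadd_ltr/(@onat_lt 0 1).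
Qed.

Lemma onat_lt_omega_exp c n : olt ozero c -> olt (onat n) (omega_exp c).
Proof. by move=> c0; elim: n => [|n]; [apply: omega_exp_gt0|apply: omega_exp_limit]. Qed.

Lemma critical_oeq a b : oeq a b -> critical a -> critical b.
Proof.
move=> [ab ba] [aw wa]; split.
  exact: ole_trans ba (ole_trans aw (omega_exp_mono ab)).
exact: ole_trans (omega_exp_mono ba) (ole_trans wa ab).
Qed.

Lemma critical_gt_onat e n : critical e -> olt (onat n) e.
Proof.
move=> [ew we]; apply: (olt_le_trans _ we); apply: onat_lt_omega_exp.
exact: olt_le_trans (omega_exp_gt0 e) we.
Qed.

Lemma onat_inj m n : oeq (onat m) (onat n) -> m = n.
Proof.
move=> [mn nm]; case: (ltngtP m n) => // /onat_lt lt; case: (@olt_irr (onat m)).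
  exact: olt_le_trans lt nm.
exact: ole_lt_trans mn lt.
Qed.

Lemma infinite_gt_onat a n : ~ ofinite a -> olt (onat n) a.
Proof.
move=> na; have [an|//] := ole_or_lt a (onat n); case: na.
have [m _ am] : exists2 m, m < n.+1 & oeq a (onat m) by apply/olt_onat/(olt_osucc a (onat n)).
by exists m.
Qed.

Definition near_critical a := exists e n, critical e /\ oeq a (oadd e (onat n)).

Lemma near_critical_gt_onat a n : near_critical a -> olt (onat n) a.
Proof.
move=> [e [m [ce [_ ea]]]]; apply: olt_le_trans (ole_trans (ole_oaddr e _) ea).
exact: critical_gt_onat.
Qed.

Variant word_exponent_spec a : Ord -> Prop :=
| ExponentFinite n x of oeq a (onat n.+1) & oeq x (onat n) : word_exponent_spec a x
| ExponentNearCritical of near_critical a : word_exponent_spec a (osucc a)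
| ExponentOther of (ole a ozero \/ ~ ofinite a) & ~ near_critical a : word_exponent_spec a a.

Lemma word_exponentP a : word_exponent_spec a (word_exponent a).
Proof.
rewrite /word_exponent; case: asboolP => [[[[|n] an] na]|fa]; first by case: na.
  apply: (@ExponentFinite _ n) => //; apply: oeq_trans (opred_succ _).
  by case: an => le ge; split; apply: opred_mono.
case: asboolP => ca; first exact: ExponentNearCritical.
apply: ExponentOther ca; have [|a0] := ole_or_lt a ozero; [by left|right => fina].
by apply: fa; split=> // -[a0' _]; apply: (@olt_irr ozero); apply: olt_le_trans a0 a0'.
Qed.

Lemma word_exponent_onat n : oeq (word_exponent (onat n.+1)) (onat n).
Proof.
have irr x y : olt x y -> ~ ole y x by move=> xy yx; apply: (@olt_irr x); apply: olt_le_trans xy yx.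
case: word_exponentP => [m x /onat_inj[->]//|/(near_critical_gt_onat n.+1)/olt_irr//|[n0|fn] _].
  by case: (irr _ _ (@onat_lt 0 n.+1 isT) n0).
by case: fn; exists n.+1; split; apply: ole_refl.
Qed.

Lemma word_exponent_le a : ole (word_exponent a) (osucc a).
Proof.
case: word_exponentP => [n x [_ na] [xn _]|_|_ _]; [|exact: ole_refl|exact/oltW/ofam_lt].
apply: ole_trans xn _; apply: ole_trans (oltW (ofam_lt (a := osucc a) tt)).
by apply: ole_trans na; apply: onat_le.
Qed.

Lemma word_exponent_near_critical a : near_critical a -> word_exponent a = osucc a.
Proof.
case: word_exponentP => // n x [an _] _ /(near_critical_gt_onat n.+1) na.
by case: (@olt_irr a); apply: ole_lt_trans na.
Qed.

Lemma word_exponent_ge a : ~ ofinite a -> ole a (word_exponent a).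
Proof.
move=> fa; case: word_exponentP => [n x an _|_|_ _]; [|exact/oltW/ofam_lt|exact: ole_refl].
by case: fa; exists n.+1.
Qed.

(** In general [a <= omega ^ a <= omega ^ omega ^ a], and equality throughout
    would make [a] critical: the shift of the exponent at critical ordinals is
    what makes this bound strict. *)
Lemma word_exponent_bound a : olt ozero a -> olt a (omega_exp (omega_exp (word_exponent a))).
Proof.
move=> a0; case: word_exponentP => [n x [an _] _|_|_ ca].
- exact: ole_lt_trans an (onat_lt_omega_exp _ (omega_exp_gt0 _)).
- apply: ole_lt_trans (omega_exp_ge a) _; apply: olt_le_trans (omega_exp_ge _).
  exact/omega_exp_lt/ofam_lt.
- have [//|wwa] := olt_or_le a (omega_exp (omega_exp a)); case: ca.
  exists a, 0; split; last exact/oeq_sym/oadd0.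
  split; first exact: omega_exp_ge.
  exact: ole_trans (omega_exp_ge _) wwa.
Qed.

(** The only danger is [b] near-critical, whose exponent is [b + 1]: if that
    reached [a] then [a] would be near-critical too, with exponent [a + 1]. *)
Lemma word_exponent_mono a b : olt ozero b -> olt b a ->
  olt (word_exponent b) (word_exponent a).
Proof.
move=> b0 ba; case: (word_exponentP a) => [n x [an _] [_ nx]|_|fa ca].
- have [[|m] mn bm] := olt_onat (olt_le_trans ba an).
    by case: (@olt_irr ozero); apply: olt_le_trans b0 bm.1.
  case: word_exponentP => [k y bk [yk _]|/(near_critical_gt_onat m.+1) mb|[b0'|fb] _].
  + apply: ole_lt_trans yk _; apply: olt_le_trans nx; apply: onat_lt.
    by have [->] : k.+1 = m.+1 by apply: onat_inj; apply: oeq_trans bm; apply: oeq_sym.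
  + by case: (@olt_irr b); apply: ole_lt_trans bm.1 mb.
  + by case: (@olt_irr ozero); apply: olt_le_trans b0 b0'.
  + by case: fb; exists m.+1.
- by apply/olt_osucc; apply: ole_trans (word_exponent_le b) _; apply/osucc_le.
- case: word_exponentP => [k y [_ kb] [yk _]|[e [n [ce [ben enb]]]]|//].
    apply: ole_lt_trans yk _; apply: olt_trans ba; apply: olt_le_trans kb.
    exact: onat_lt.
  have [//|ab] := olt_or_le (osucc b) a; case: ca; exists e, n.+1; split=> //.
  have [es se] := oadd_onatS e n; split.
    by apply: ole_trans ab _; apply: ole_trans se; apply: ole_lt_osucc.
  by apply: ole_trans es _; apply/osucc_le; apply: ole_lt_trans ba.
Qed.

(** Below [word_exponent a], everything is reached by the exponents of
    positive ordinals [b < a], except at a critical [a], where the exponents of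
    smaller ordinals only reach [a] itself. *)
Lemma word_exponent_cofinal a d : olt ozero a -> olt d (word_exponent a) ->
  (exists b, [/\ olt ozero b, olt b a & ole d (word_exponent b)]) \/
  (critical a /\ ole d a).
Proof.
move=> a0; case: word_exponentP => [n x [_ na] [xn _] dx|[e [n [ce aen]]] /olt_osucc da|fa ca da].
- left; have [|m mn [dm _]] := @olt_onat d n; first exact: olt_le_trans xn.
  exists (onat m.+1); split; first exact: (@onat_lt 0).
    by apply: olt_le_trans na; apply: onat_lt.
  exact: ole_trans dm (word_exponent_onat m).2.
- case: n aen => [|n] aen.
    right; split=> //; apply: critical_oeq ce; apply/oeq_sym.
    exact: oeq_trans aen (oadd0 e).
  left; exists (oadd e (onat n)); split.
  + by apply: olt_le_trans (ole_oaddr _ _); apply: (critical_gt_onat 0).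
  + by apply: olt_le_trans aen.2; apply/oadd_lt/onat_lt.
  + rewrite word_exponent_near_critical; last by exists e, n; do !split=> //; apply: ole_refl.
    apply: ole_trans da _; apply: ole_trans aen.1 _; exact: (oadd_onatS e n).1.
- have {}fa : ~ ofinite a.
    by case: fa => // /(olt_le_trans a0)/olt_irr.
  left; have [[n [dn _]]|fd] := pselect (ofinite d).
    exists (onat n.+1); split; [exact: (@onat_lt 0)|exact: infinite_gt_onat|].
    exact: ole_trans dn (word_exponent_onat n).2.
  exists d; split=> //; [exact: (infinite_gt_onat 0)|exact: word_exponent_ge].
Qed.

(** * Statures of subspaces *)

Section SubspaceStature.
Variable T : topologicalType.
Implicit Types (Y Z B C D : set T) (a b c d e : Ord).

(** The subspace [Y] has stature at most [a].  The recursion on [a] makes sense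
    before closed subsets are known to be well-founded, and implies that they are
    (see [stat_le_wf]).  The closed subsets of [Y] are its intersections with closed subsets of [T]. *)
Fixpoint stat_le (a : Ord) (Y : set T) : Prop :=
  let: osup A f := a in
  forall C, closed C -> ~ Y `<=` C -> exists i, stat_le (f i) (Y `&` C).

(** The subspace [Y] has stature at least [a]. *)
Fixpoint stat_ge (a : Ord) (Y : set T) : Prop :=
  let: osup A f := a in
  forall i, exists C, [/\ closed C, ~ Y `<=` C & stat_ge (f i) (Y `&` C)].

Lemma stat_le_sub a Y Z : Y `<=` Z -> stat_le a Z -> stat_le a Y.
Proof.
elim: a Y Z => A f IH Y Z YZ aZ C clC YC.
have [|i iZ] := aZ C clC; first by move=> ZC; apply: YC; apply: subset_trans ZC.
by exists i; apply: IH iZ; apply: setSI.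
Qed.

Lemma stat_ge_sub a Y Z : Y `<=` Z -> stat_ge a Y -> stat_ge a Z.
Proof.
elim: a Y Z => A f IH Y Z YZ aY i; have [C [clC YC fC]] := aY i; exists C; split=> //.
  by move=> ZC; apply: YC; apply: subset_trans ZC.
by apply: IH fC; apply: setSI.
Qed.

Lemma stat_leP a Y : stat_le a Y <->
  forall C, closed C -> ~ Y `<=` C -> exists2 b, olt b a & stat_le b (Y `&` C).
Proof.
have mono : forall a b Y, ole a b -> stat_le a Y -> stat_le b Y.
  move=> {}a b; elim: b a => B g IH [A f] Z ab aZ C clC ZC.
  have [i iZ] := aZ C clC ZC; have [j ij] := ab i.
  by exists j; apply: IH iZ.
case: a => A f; split=> [aY|aY] C clC YC.
  by have [i iY] := aY C clC YC; exists (f i) => //; apply: (@ofam_lt (osup f)).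
by have [b [i bi] bY] := aY C clC YC; exists i; apply: mono bY.
Qed.

Lemma stat_geP a Y : stat_ge a Y <->
  forall b, olt b a -> exists C, [/\ closed C, ~ Y `<=` C & stat_ge b (Y `&` C)].
Proof.
have mono : forall a b Y, ole a b -> stat_ge b Y -> stat_ge a Y.
  elim=> A f IH [B g] Z ab bZ i; have [j ij] := ab i.
  have [C [clC ZC gC]] := bZ j; exists C; split=> //; exact: IH gC.
case: a => A f; split=> [aY b [i bi]|aY i].
  have [C [clC YC fC]] := aY i; exists C; split=> //; exact: mono fC.
exact/aY/(@ofam_lt (osup f)).
Qed.

Lemma stat_le_mono a b Y : ole a b -> stat_le a Y -> stat_le b Y.
Proof.
move=> ab /stat_leP aY; apply/stat_leP => C clC YC.
by have [d da dY] := aY C clC YC; exists d => //; apply: olt_le_trans ab.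
Qed.

Lemma stat_ge_mono a b Y : ole a b -> stat_ge b Y -> stat_ge a Y.
Proof.
by move=> ab /stat_geP bY; apply/stat_geP => d da; apply: bY; apply: olt_le_trans ab.
Qed.

Lemma stat_le0 Y : stat_le ozero Y -> Y = set0.
Proof.
move=> Y0; rewrite -subset0; apply: contrapT => /(Y0 _ closed0)[[]].
Qed.

Lemma stat_le_set0 a : stat_le a set0.
Proof. by apply/stat_leP => C _ []; apply: sub0set. Qed.

Lemma stat_le1 x : stat_le (onat 1) [set x].
Proof.
apply/stat_leP => C _ xC; exists ozero; first exact: (@onat_lt 0 1).
by apply: stat_le_sub (stat_le_set0 _) => y [-> Cx]; apply: xC => _ ->.
Qed.

Lemma stat_ge1 Y : Y !=set0 -> stat_ge (onat 1) Y.
Proof.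
move=> [y Yy]; apply/stat_geP => b /olt_osucc b0; exists set0.
by split=> [|/(_ y Yy)//|]; [apply: closed0|apply: stat_ge_mono b0 _; case].
Qed.

Section ClosedSets.
Hypothesis wf : well_founded (@closed_set_lt T).

Lemma closed_set_ltI (D : closed_set T) C (clC : closed C) :
  ~ sval D `<=` C ->
  closed_set_lt (exist _ (sval D `&` C) (closedI (svalP D) clC)) D.
Proof. by move=> DC; split=> [x []//|/= DD]; apply: DC => x /DD[]. Qed.

Lemma stat_le_rk (D : closed_set T) : stat_le (rk wf D) (sval D).
Proof.
elim/(well_founded_ind wf): D => D IH; rewrite rkE => C clC DC.
by exists (exist (fun E => closed_set_lt E D) _ (closed_set_ltI clC DC));
  exact: (IH _ (closed_set_ltI clC DC)).
Qed.

Lemma stat_ge_rk (D : closed_set T) : stat_ge (rk wf D) (sval D).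
Proof.
elim/(well_founded_ind wf): D => D IH; rewrite rkE => -[C CD].
have [sCD DC] := CD; exists (sval C); split=> //; first exact: svalP.
by rewrite (setIidr sCD); apply: IH.
Qed.

Lemma rk_le_stat a (D : closed_set T) : stat_le a (sval D) -> ole (rk wf D) a.
Proof.
elim: a D => A f IH D aD; rewrite rkE => -[C CD]; have [sCD DC] := CD.
have [i] := aD _ (svalP C) DC; rewrite (setIidr sCD) => iC.
by exists i; apply: IH.
Qed.

Lemma rk_ge_stat a (D : closed_set T) : stat_ge a (sval D) -> ole a (rk wf D).
Proof.
elim: a D => A f IH D aD; apply/oleP => i; have [C [clC DC fC]] := aD i.
apply: (@ole_lt_trans (rk wf (exist _ (sval D `&` C) (closedI (svalP D) clC)))).
  exact: IH.
rewrite [rk wf D]rkE; exists (exist (fun E => closed_set_lt E D) _ (closed_set_ltI clC DC)).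
exact: ole_refl.
Qed.

End ClosedSets.

Lemma stat_le_wf a : stat_le a setT -> well_founded (@closed_set_lt T).
Proof.
have acc : forall a (D : closed_set T), stat_le a (sval D) -> Acc (@closed_set_lt T) D.
  elim=> A f IH D aD; constructor=> C [sCD DC].
  by have [i] := aD _ (svalP C) DC; rewrite (setIidr sCD) => /IH.
by move=> aT D; apply: acc; apply: stat_le_sub aT.
Qed.

Lemma stature_le (nT : noetherian T) : stat_le (stature T) setT.
Proof.
have wf := noetherian_wf nT; have [_ le] := stature_rk wf.
exact: stat_le_mono le (stat_le_rk wf (whole T)).
Qed.

Lemma stature_ge (nT : noetherian T) : stat_ge (stature T) setT.
Proof.
have wf := noetherian_wf nT; have [le _] := stature_rk wf.
exact: stat_ge_mono le (stat_ge_rk wf (whole T)).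
Qed.

Lemma stature_eq a : stat_le a setT -> stat_ge a setT -> oeq (stature T) a.
Proof.
move=> leT geT; have wf := stat_le_wf leT; apply: oeq_trans (stature_rk wf) _.
by split; [apply: (@rk_le_stat wf _ (whole T))|apply: (@rk_ge_stat wf _ (whole T))].
Qed.

(** ** Unions and differences *)

Lemma stat_leU a b Y Z : stat_le a Y -> stat_le b Z -> stat_le (onadd a b) (Y `|` Z).
Proof.
elim: a b Y Z => A f IHa; elim=> B g IHb Y Z aY bZ; apply/stat_leP => C clC YZC.
have [YC|YC] := pselect (Y `<=` C).
  have [|j jZ] := bZ C clC; first by move=> ZC; apply: YZC => x [/YC|/ZC].
  exists (onadd (osup f) (g j)); first exact/onadd_ltr/(@ofam_lt (osup g)).
  rewrite setIUl; apply: IHb => //; exact: stat_le_sub aY.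
have [i iY] := aY C clC YC.
exists (onadd (f i) (osup g)); first exact/onadd_ltl/(@ofam_lt (osup f)).
rewrite setIUl; apply: IHa => //; exact: stat_le_sub bZ.
Qed.

(** First climb the closed subsets of [Y `&` B], then those containing
    [Y `&` B], which correspond to the closed subsets of [Y `\` B]. *)
Lemma stat_geD a b Y B : closed B -> stat_ge a (Y `&` B) -> stat_ge b (Y `\` B) ->
  stat_ge (oadd a b) Y.
Proof.
move=> clB; elim: b Y => J g IH Y aY bY; apply/stat_geP => x /olt_oadd[xa|[j xj]].
  move: aY => /stat_geP/(_ x xa)[C [clC YC xC]]; exists C; split=> //.
    by move=> YsC; apply: YC => z [/YsC].
  by apply: stat_ge_sub xC => z [[]].
have [C [clC YC gC]] := bY j; exists (B `|` C); split.
- exact: closedU.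
- by move=> YBC; apply: YC => z [/YBC[]].
apply: (stat_ge_mono xj); apply: IH.
  by apply: stat_ge_sub aY => z [Yz Bz]; do !split=> //; left.
by apply: stat_ge_sub gC => z [[Yz Bz] Cz]; do !split=> //; right.
Qed.

(** Left cancellation of [a]: the closed sets of [Y] that contain [Y `&` B] form
    a copy of those of [Y `\` B], above a set of stature at least [a]. *)
Lemma stat_leD a b Y B : closed B ->
  (forall a', olt a' a -> ~ stat_le a' (Y `&` B)) ->
  stat_le (oadd a b) Y -> stat_le b (Y `\` B).
Proof.
move=> clB; elim: b Y => J g IH Y aY /stat_leP abY C clC YC.
have [|x xab xY] := abY (B `|` C) (closedU clB clC).
  by move=> YBC; apply: YC => z [/YBC[]].
have YB : (Y `&` (B `|` C)) `&` B = Y `&` B.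
  by rewrite predeqE => z; split=> [[[]]|[]] // Yz Bz; do !split=> //; left.
move: xab => /olt_oadd[xa|[j xj]].
  by case: (aY x xa); apply: stat_le_sub xY => z; rewrite -{1}YB => -[].
exists j; apply: stat_le_sub (IH j (Y `&` (B `|` C)) _ _).
- by move=> z [[Yz Bz] Cz]; do !split=> //; right.
- by rewrite YB.
- exact: stat_le_mono xY.
Qed.

(** If the stature of [Y] exceeds [a], some closed subset of [Y] has stature
    exactly [a], since the statures of closed subsets have no gaps; what remains
    of [Y] then has stature at most [b] by cancellation. *)
Lemma stat_le_split a b Y : stat_le (oadd a b) Y ->
  exists B, stat_le a (Y `&` B) /\ stat_le b (Y `\` B).
Proof.
move=> abY; suff [aY|[B [clB aYB naYB]]] : stat_le a Y \/ exists B,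
    [/\ closed B, stat_le a (Y `&` B) & forall a', olt a' a -> ~ stat_le a' (Y `&` B)].
- by exists setT; rewrite setIT setDT; split=> //; apply: stat_le_set0.
- by exists B; split=> //; apply: stat_leD abY.
move: (oadd a b) abY => e; elim: e Y => E f IH Y eY.
case: (pselect (stat_le a Y)) => [|naY]; [by left|right].
have [C [clC YC aYC]] : exists C, [/\ closed C, ~ Y `<=` C &
    forall a', olt a' a -> ~ stat_le a' (Y `&` C)].
  apply: contrapT => /forallNP nC; apply: naY; apply/stat_leP => C clC YC.
  by apply: contrapT => na; apply: (nC C); split=> // a' a'a a'Y; apply: na; exists a'.
have [i /IH[aC|[B [clB aB naB]]]] := eY C clC YC.
  by exists C.
exists (C `&` B); rewrite setIA; split=> //; exact: closedI.
Qed.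

(** ** Statures below a power of omega *)

Definition stat_lt (a : Ord) (Y : set T) : Prop := exists2 b, olt b a & stat_le b Y.

Lemma stat_lt_sub a Y Z : Y `<=` Z -> stat_lt a Z -> stat_lt a Y.
Proof. by move=> YZ [b ba bZ]; exists b => //; apply: stat_le_sub bZ. Qed.

Lemma stat_ltU c Y Z : stat_lt (omega_exp c) Y -> stat_lt (omega_exp c) Z ->
  stat_lt (omega_exp c) (Y `|` Z).
Proof.
move=> [a ac aY] [b bc bZ]; exists (onadd a b); last exact: stat_leU.
exact: omega_exp_onadd_closed.
Qed.

(** A subspace of stature below [omega ^ c] is a finite union of subspaces of
    statures at most [omega ^ d], [d < c].  The pieces are not closed, which is why
    statures are considered for arbitrary subsets. *)
Lemma stat_lt_omega_exp_ind c (Q : set T -> Prop) :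
  Q set0 -> (forall Y Z, Q Y -> Q Z -> Q (Y `|` Z)) ->
  (forall Y d, olt d c -> stat_le (omega_exp d) Y -> Q Y) ->
  forall Y, stat_lt (omega_exp c) Y -> Q Y.
Proof.
move=> Q0 QU Qexp Y [b /olt_omega_exp[b0 bY|[j [n bn bY]]]].
  by rewrite (stat_le0 (stat_le_mono b0 bY)).
have := stat_le_mono bn bY; elim: n Y {b bn bY} => [|n IH] Y nY.
  by rewrite (stat_le0 (stat_le_mono _ nY)) //; apply/ole_omulP => -[].
have [B [YB YnB]] := stat_le_split (stat_le_mono (omul_osucc _ (onat n)).1 nY).
have -> : Y = (Y `&` B) `|` (Y `\` B) by rewrite setUIDK.
by apply: QU; [apply: IH|apply: Qexp YnB; apply: ofam_lt].
Qed.

End SubspaceStature.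

(** * The topology of words *)

Section Words.
Variable X : topologicalType.
Implicit Types (F U V G : set X) (Us Vs Ws : seq (set X)) (u v w : words X).

Lemma word_open_cons U Us w : word_open (U :: Us) w <->
  exists u x v, [/\ w = u ++ x :: v, U x & word_open Us v].
Proof.
split=> [[u _ [_ [_ [x Ux <-] [v Uv <-]] <-]]|[u [x [v [-> Ux Uv]]]]].
  by exists u, x, v.
exists u => //; exists (x :: v) => //; exists [:: x]; first by exists x.
by exists v.
Qed.

Lemma word_open_catl Us u v : word_open Us v -> word_open Us (u ++ v).
Proof.
case: Us => // U Us /word_open_cons[v1 [x [v2 [-> Ux v2P]]]].
by apply/word_open_cons; exists (u ++ v1), x, v2; rewrite catA.
Qed.

Lemma word_open_catr Us u v : word_open Us u -> word_open Us (u ++ v).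
Proof.
elim: Us u => // U Us IH u /word_open_cons[u1 [x [u2 [-> Ux /IH u2P]]]].
by apply/word_open_cons; exists u1, x, (u2 ++ v); rewrite -catA.
Qed.

Lemma word_open_cat Us Vs u v :
  word_open Us u -> word_open Vs v -> word_open (Us ++ Vs) (u ++ v).
Proof.
move=> + vP; elim: Us u => [|U Us IH] u; first by move=> _; apply: word_open_catl.
move=> /word_open_cons[u1 [x [u2 [-> Ux /IH u2P]]]].
by apply/word_open_cons; exists u1, x, (u2 ++ v); rewrite -catA.
Qed.

Lemma word_open_catP Us Vs w : word_open (Us ++ Vs) w ->
  exists u v, [/\ w = u ++ v, word_open Us u & word_open Vs v].
Proof.
elim: Us w => [|U Us IH] w; first by exists [::], w.
move=> /word_open_cons[w1 [x [_ [-> Ux /IH[u [v [-> uP vP]]]]]]].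
exists (w1 ++ x :: u), v; rewrite -catA; split=> //.
by apply/word_open_cons; exists w1, x, u.
Qed.

Lemma word_open_nseq n G w :
  word_open (nseq n G) w <-> n <= count (fun x => `[< G x >]) w.
Proof.
elim: n w => [|n IH] w /=; first by split.
split=> [/word_open_cons[u [x [v [-> Gx /IH nv]]]]|].
  by rewrite count_cat /= (asboolT Gx) addnCA add1n ltnS (leq_trans nv) // leq_addl.
elim: w => //= x w IHw; case: asboolP => [Gx|_ /IHw].
  by rewrite add1n ltnS => /IH wn; apply/word_open_cons; exists [::], x, w.
by apply: (@word_open_catl (nseq n.+1 G) [:: x]).
Qed.

Lemma word_open_nseqT n w : word_open (nseq n setT) w <-> n <= size w.
Proof.
rewrite word_open_nseq; suff /eqP-> : count (fun x => `[< [set: X] x >]) w == size w by [].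
by rewrite -all_count; apply/allP => y _; apply: asboolT.
Qed.

Lemma open_word_open Us : {in Us, forall U, open U} -> open (word_open Us : set (words X)).
Proof.
move=> oU; exists [set word_open Us]; last by rewrite bigcup_set1.
move=> _ ->; exists (finmap.fset1 (word_open Us)).
  by move=> V; rewrite finmap.inE => /eqP->; rewrite inE; exists Us.
rewrite predeqE => w; split=> [|wU V /=]; first by apply; rewrite /= finmap.inE.
by rewrite finmap.inE => /eqP->.
Qed.

(** Among the basic opens that contain [w], those with exactly one set per letter
    of [w] are cofinal, and they are easy to intersect and to cut. *)
Fixpoint box Us w : Prop :=
  match Us, w with
  | [::], [::] => True
  | U :: Us', x :: w' => U x /\ box Us' w'
  | _, _ => False
  end.

Lemma box_word_open Us w : box Us w -> word_open Us w.
Proof.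
elim: Us w => [|U Us IH] [|x w] //= [Ux /IH wP].
by apply/word_open_cons; exists [::], x, w.
Qed.

Lemma box_catP Us u v : box Us (u ++ v) ->
  exists Vs Ws, [/\ Us = Vs ++ Ws, box Vs u & box Ws v].
Proof.
elim: u Us => [|x u IH] [|U Us] //=; [by exists [::], [::]|by exists [::], (U :: Us)|].
by move=> [Ux /IH[Vs [Ws [-> uP vP]]]]; exists (U :: Vs), Ws.
Qed.

Lemma word_open_box Us w : {in Us, forall U, open U} -> word_open Us w ->
  exists Vs, [/\ {in Vs, forall V, open V}, box Vs w & word_open Vs `<=` word_open Us].
Proof.
have pad u w' Vs : {in Vs, forall V, open V} -> box Vs w' ->
    exists Ws, [/\ {in Ws, forall V, open V}, box Ws (u ++ w') & word_open Ws `<=` word_open Vs].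
  move=> oV bV; elim: u => [|x u [Ws [oW bW sW]]] /=.
    by exists Vs; split.
  exists (setT :: Ws); split=> //.
    by move=> V; rewrite inE => /orP[/eqP->|/oW//]; apply: openT.
  move=> z /word_open_cons[z1 [y [z2 [-> _ /sW]]]].
  by rewrite -cat1s catA; apply: word_open_catl.
elim: Us w => [|U Us IH] w oU; first by have := pad w [::] [::]; rewrite cats0; apply.
move=> /word_open_cons[u [x [v [-> Ux vP]]]].
have [|Vs [oV bV sV]] := IH v _ vP; first by move=> V VU; apply: oU; rewrite inE VU orbT.
have [||Ws [oW bW sW]] := pad u (x :: v) (U :: Vs).
- by move=> V; rewrite inE => /orP[/eqP->|/oV//]; apply: oU; rewrite inE eqxx.
- by [].
exists Ws; split=> //; apply: subset_trans sW _ => z /word_open_cons[z1 [y [z2 [-> Uy /sV z2P]]]].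
by apply/word_open_cons; exists z1, y, z2.
Qed.

Lemma box_meet Us Vs w : {in Us, forall U, open U} -> {in Vs, forall V, open V} ->
  box Us w -> box Vs w ->
  exists Ws, [/\ {in Ws, forall W, open W}, box Ws w &
    word_open Ws `<=` word_open Us `&` word_open Vs].
Proof.
elim: w Us Vs => [|x w IH] [|U Us] [|V Vs] //= oU oV; first by exists [::].
move=> [Ux wU] [Vx wV]; have [||Ws [oW bW sW]] := IH Us Vs _ _ wU wV.
- by move=> W WU; apply: oU; rewrite inE WU orbT.
- by move=> W WV; apply: oV; rewrite inE WV orbT.
exists (U `&` V :: Ws); split=> //.
  move=> W; rewrite inE => /orP[/eqP->|/oW//].
  by apply: openI; [apply: oU|apply: oV]; rewrite inE eqxx.
move=> z /word_open_cons[z1 [y [z2 [-> [Uy Vy] /sW[z2U z2V]]]]].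
by split; apply/word_open_cons; exists z1, y, z2.
Qed.

(** The subbasic sets form a base: replace each subbasic neighbourhood of [w] by
    one with one set per letter of [w], and intersect letter by letter. *)
Lemma words_openP (O : set (words X)) w : open O -> O w ->
  exists Us, [/\ {in Us, forall U, open U}, box Us w & word_open Us `<=` O].
Proof.
move=> [F sF <-] [B FB Bw]; have [D sD DB] := sF B FB.
pose s : seq (set (words X)) := finmap.enum_fset D.
have sB z : (forall V : set (words X), V \in s -> V z) -> B z by rewrite -DB => sz V; apply: sz.
have sP (V : set (words X)) : V \in s -> exists Us, [/\ {in Us, forall U, open U},
    word_open Us w & word_open Us `<=` V].
  move=> Vs; have := sD V Vs; rewrite inE => -[Us oU eU]; exists Us.
  have Vw : V w by move: Bw; rewrite -DB; apply.
  by move: Vw; rewrite -eU; split.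
suff [Us [oU bU sU]] : exists Us, [/\ {in Us, forall U, open U}, box Us w &
    forall V : set (words X), V \in s -> word_open Us `<=` V].
  exists Us; split=> // z zU; exists B => //; apply: sB => V Vs; exact: sU zU.
move: s sP {sB}; elim=> [|V s IH] sP.
  have [Us [oU bU _]] : exists Us, [/\ {in Us, forall U, open U}, box Us w &
      word_open Us `<=` word_open [::]] by apply: word_open_box.
  by exists Us.
have [Us [oU wU UV]] := sP V (mem_head _ _).
have [Vs [oV bV sV]] := word_open_box oU wU.
have [|Ws [oW bW sW]] := IH; first by move=> Z Zs; apply: sP; rewrite inE Zs orbT.
have [Zs [oZ bZ sZ]] := box_meet oV oW bV bW.
exists Zs; split=> // Z; rewrite inE => /orP[/eqP-> z /sZ[/sV/UV]//|Zs' z /sZ[_]].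
exact: sW.
Qed.

Lemma words_open (O : set (words X)) :
  (forall w, O w -> exists Us,
    [/\ {in Us, forall U, open U}, word_open Us w & word_open Us `<=` O]) ->
  open O.
Proof.
move=> OP; have -> : O = \bigcup_(Us in [set Us : seq (set X) |
    {in Us, forall U, open U} /\ word_open Us `<=` O]) word_open Us.
  rewrite predeqE => w; split=> [/OP[Us [oU wU sU]]|[Us [_ sU] /sU]//].
  by exists Us.
by apply: bigcup_open => Us [oU _]; apply: open_word_open.
Qed.

(** The left factor absorbs the letters skipped before [G], because open sets of
    words are closed under insertion of letters. *)
Lemma open_lcat_letter (O O' : set (words X)) G : open O -> open O' -> open G ->
  open ([set w | exists u x v, [/\ w = u ++ x :: v, O u, G x & O' v]] : set (words X)).
Proof.
move=> oO oO' oG; apply: words_open => _ [u [x [v [-> Ou Gx O'v]]]].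
have [Us [oU /box_word_open uU sU]] := words_openP oO Ou.
have [Vs [oV /box_word_open vV sV]] := words_openP oO' O'v.
exists (Us ++ G :: Vs); split.
- by move=> W; rewrite mem_cat inE => /or3P[/oU|/eqP->|/oV].
- apply: word_open_cat => //; apply/word_open_cons; by exists [::], x, v.
- move=> w /word_open_catP[u' [v' [-> /sU Ou' /word_open_cons[v1 [y [v2 [-> Gy /sV Ov2]]]]]]].
  exists (u' ++ v1), y, v2; rewrite -catA; split=> //.
  have := words_openP oO Ou'; case=> Zs [oZ /box_word_open bZ sZ].
  by apply: sZ; apply: word_open_catr.
Qed.

(** Continuity of concatenation. *)
Lemma closed_lcat_sep (C : set (words X)) u v : closed C -> ~ C (u ++ v) -> exists O O',
  [/\ open O, open O', O u, O' v & forall u' v', O u' -> O' v' -> ~ C (u' ++ v')].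
Proof.
move=> /closed_openC oC Cuv; have [Us [oU bU sU]] := words_openP oC Cuv.
have [Vs [Ws [eU /box_word_open uV /box_word_open vW]]] := box_catP bU.
exists (word_open Vs), (word_open Ws); split=> //.
- by apply: open_word_open => V VV; apply: oU; rewrite eU mem_cat VV.
- by apply: open_word_open => V VV; apply: oU; rewrite eU mem_cat VV orbT.
- by move=> u' v' u'V v'W; apply: sU; rewrite eU; apply: word_open_cat.
Qed.

Lemma closed_letter (C : set (words X)) : closed C -> closed [set x : X | C [:: x]].
Proof.
move=> /closed_openC oC; rewrite -[[set x : X | _]]setCK; apply: open_closedC.
rewrite openE => x nC.
have [[|U [|U' Us]] [oU bU sU]] := words_openP oC nC; [by case: bU| |by case: bU].
rewrite /interior nbhsE; exists U.
  by split; [apply: oU; rewrite mem_head|case: bU].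
by move=> y Uy; apply: sU; apply: box_word_open; split.
Qed.

Definition star F : set (words X) := [set w | {in (w : seq X), forall x, F x}].

Lemma star_cons F x w : star F (x :: w) <-> F x /\ star F w.
Proof.
split=> [Fw|[Fx Fw] y]; last by rewrite inE => /orP[/eqP->|/Fw].
by split=> [|y yw]; apply: Fw; rewrite inE ?eqxx ?yw ?orbT.
Qed.

Lemma star_cat F u v : star F (u ++ v) <-> star F u /\ star F v.
Proof.
elim: u => [|x u IH] /=; first by split=> [|[]].
by rewrite !star_cons IH; split=> [[? []]|[[]]].
Qed.

(** Cut [w] at its first letter in [U]. *)
Lemma star_first F U w : star F w -> star (F `\` U) w \/
  exists u x v, [/\ w = u ++ x :: v, star (F `\` U) u, F x, U x & star F v].
Proof.
elim: w => [|x w IH] /=; first by left.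
move=> /star_cons[Fx Fw]; have [Ux|nUx] := pselect (U x).
  by right; exists [::], x, w.
have [wU|[u [y [v [-> uU Fy Uy Fv]]]]] := IH Fw; first by left; apply/star_cons.
by right; exists (x :: u), y, v; split=> //; apply/star_cons.
Qed.

Lemma box_meets F Us w U : star F w -> box Us w -> U \in Us -> ~ F `<=` ~` U.
Proof.
elim: Us w => [|V Us IH] [|x w] //= /star_cons[Fx Fw] [Vx bw].
rewrite inE => /orP[/eqP->|UU]; first by move=> /(_ x Fx); apply.
exact: IH bw UU.
Qed.

End Words.

(** * The upper bound *)

Section UpperBound.
Variable X : topologicalType.
Implicit Types (F U : set X) (Us : seq (set X)) (L M C O : set (words X)).

Lemma stat_lt_set0 (T : topologicalType) c : stat_lt (omega_exp c) (set0 : set T).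
Proof. by exists ozero; [apply: omega_exp_gt0|apply: stat_le_set0]. Qed.

(** A proper closed subset [C] of [L M] misses an open rectangle around some
    [u ++ v], so it lies in [L' M `|` L M'] where [L'] and [M'] are proper closed
    subsets of [L] and [M].  These split into finitely many pieces whose statures
    are smaller powers of omega, to which induction applies. *)
Lemma stat_le_lcat c d L M : stat_le (omega_exp c) L -> stat_le (omega_exp d) M ->
  stat_le (omega_exp (onadd c d)) (lcat L M).
Proof.
elim: c d L M => A f IHc; elim=> B g IHd L M cL dM; apply/stat_leP => C clC LMC.
have [w [[u Lu [v Mv <-{w}]] nC]] := nonsubset LMC.
have [O [O' [oO oO' Ou O'v OC]]] := closed_lcat_sep clC nC.
have LO : stat_lt (omega_exp (osup f)) (L `&` ~` O).
  by move: cL => /stat_leP/(_ _ (open_closedC oO)); apply => /(_ u Lu); apply.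
have MO : stat_lt (omega_exp (osup g)) (M `&` ~` O').
  by move: dM => /stat_leP/(_ _ (open_closedC oO')); apply => /(_ v Mv); apply.
apply: (@stat_lt_sub _ _ _ (lcat (L `&` ~` O) M `|` lcat L (M `&` ~` O'))).
  move=> _ [[u' Lu' [v' Mv' <-]] Cuv].
  have [Ou'|Ou'] := pselect (O u'); last by left; exists u'; last by exists v'.
  right; exists u' => //; exists v' => //; split=> // O'v'; exact: OC Cuv.
apply: stat_ltU.
- apply: (@stat_lt_omega_exp_ind _ (osup f)
    (fun Z => stat_lt (omega_exp (onadd (osup f) (osup g))) (lcat Z M))) LO.
  + by apply: stat_lt_sub (stat_lt_set0 _ _) => ? [? []].
  + move=> Y Z YM ZM; apply: stat_lt_sub (stat_ltU YM ZM).
    by move=> _ [y [Yy|Zy] [z Mz <-]]; [left|right]; exists y => //; exists z.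
  + move=> Y e [i ei] eY; exists (omega_exp (onadd (f i) (osup g))).
      exact/omega_exp_lt/onadd_ltl/(@ofam_lt (osup f)).
    by apply: IHc => //; apply: stat_le_mono eY; apply: omega_exp_mono.
- apply: (@stat_lt_omega_exp_ind _ (osup g)
    (fun Z => stat_lt (omega_exp (onadd (osup f) (osup g))) (lcat L Z))) MO.
  + by apply: stat_lt_sub (stat_lt_set0 _ _) => ? [? _ [? []]].
  + move=> Y Z YM ZM; apply: stat_lt_sub (stat_ltU YM ZM).
    by move=> _ [y Ly [z [Yz|Zz] <-]]; [left|right]; exists y => //; exists z.
  + move=> Y e [i ei] eY; exists (omega_exp (onadd (osup f) (g i))).
      exact/omega_exp_lt/onadd_ltr/(@ofam_lt (osup g)).
    by apply: IHd => //; apply: stat_le_mono eY; apply: omega_exp_mono.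
Qed.

(** Powers of omega multiply to a power whose exponent is the natural sum of
    the exponents, and [omega ^ c] is closed under natural sums. *)
Lemma stat_lt_lcat c L M : stat_lt (omega_exp (omega_exp c)) L ->
  stat_lt (omega_exp (omega_exp c)) M -> stat_lt (omega_exp (omega_exp c)) (lcat L M).
Proof.
set e := omega_exp c => Le; apply: (@stat_lt_omega_exp_ind _ e
  (fun Z => stat_lt (omega_exp e) (lcat L Z))).
- by apply: stat_lt_sub (stat_lt_set0 _ _) => ? [? _ [? []]].
- move=> Y Z YM ZM; apply: stat_lt_sub (stat_ltU YM ZM).
  by move=> _ [y Ly [z [Yz|Zz] <-]]; [left|right]; exists y => //; exists z.
move=> {}M d de dM; move: L Le; apply: stat_lt_omega_exp_ind.
- by apply: stat_lt_sub (stat_lt_set0 _ _) => ? [? []].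
- move=> Y Z YM ZM; apply: stat_lt_sub (stat_ltU YM ZM).
  by move=> _ [y [Yy|Zy] [z Mz <-]]; [left|right]; exists y => //; exists z.
move=> L d' d'e d'L; exists (omega_exp (onadd d' d)); last exact: stat_le_lcat.
exact/omega_exp_lt/omega_exp_onadd_closed.
Qed.

Lemma stat_le_letters a F : stat_le a F -> stat_le a (letters F : set (words X)).
Proof.
elim: a F => A f IH F aF C clC FC.
have [|i iF] := aF _ (closed_letter clC).
  by move=> sFC; apply: FC => _ [x Fx <-]; apply: sFC.
exists i; apply: (stat_le_sub _ (IH i _ iF)).
by move=> _ [[x Fx <-] Cx]; exists x.
Qed.

(** A word over [F] that avoids [X^* U X^* U_2 ... X^*] has no letter in [U], or
    is [u x v] with [x] its first letter in [U], so that [u] is over [F `\` U], and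
    [v] avoids [X^* U_2 ... X^*]. *)
Lemma stat_lt_avoid c F Us (e := omega_exp (omega_exp c)) :
  stat_lt e (letters F `|` [set [::]] : set (words X)) ->
  (forall U, U \in Us -> stat_lt e (star (F `\` U))) ->
  stat_lt e (star F `\` word_open Us).
Proof.
move=> eF; elim: Us => [|U Us IH] eU.
  by apply: stat_lt_sub (stat_lt_set0 _ _) => w [_ []].
have eUF := eU U (mem_head _ _).
have {}IH : stat_lt e (star F `\` word_open Us).
  by apply: IH => V VU; apply: eU; rewrite inE VU orbT.
apply: stat_lt_sub (stat_ltU eUF (stat_lt_lcat eUF (stat_lt_lcat eF IH))) => w [Fw nw].
have [|[u [x [v [ew uU Fx Ux Fv]]]]] := star_first U Fw; [by left|right].
rewrite ew; exists u => //; exists (x :: v) => //; exists [:: x]; first by left; exists x.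
exists v => //; split=> // Uv; apply: nw; rewrite ew.
by apply/word_open_cons; exists u, x, v.
Qed.

(** The sets [U] for which the hypothesis is required are those that meet [F]:
    a basic open set containing a word over [F] only involves such sets. *)
Lemma stat_le_star_of c F (e := omega_exp (omega_exp c)) :
  stat_lt e (letters F `|` [set [::]] : set (words X)) ->
  (forall U, open U -> ~ F `<=` ~` U -> stat_lt e (star (F `\` U))) ->
  stat_le e (star F).
Proof.
move=> eF eU; apply/stat_leP => C clC FC.
have [w [Fw nC]] := nonsubset FC.
have [Us [oU bU sU]] := words_openP (closed_openC clC) nC.
apply: (@stat_lt_sub _ _ _ (star F `\` word_open Us)).
  by move=> z [Fz Cz]; split=> // /sU.
by apply: stat_lt_avoid => // U UU; apply: eU; [apply: oU|apply: box_meets bU UU].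
Qed.

End UpperBound.

(** Removing an open set that meets [F] decreases the stature, hence the
    exponent. *)
Lemma stat_le_star (X : topologicalType) a (F : set X) : olt ozero a -> stat_le a F ->
  stat_le (omega_exp (omega_exp (word_exponent a))) (star F).
Proof.
elim: a F => A f IH F a0 aF.
have w1 : olt (onat 1) (omega_exp (omega_exp (word_exponent (osup f)))).
  exact/omega_exp_gt1/omega_exp_gt0.
apply: stat_le_star_of => [|U oU FU].
  exists (onadd (osup f) (onat 1)).
    by apply: omega_exp_onadd_closed => //; apply: word_exponent_bound.
  by apply: stat_leU; [apply: stat_le_letters|apply: stat_le1].
have [i iF] := aF _ (open_closedC oU) FU.
have [i0|i0] := ole_or_lt (f i) ozero.
  exists (onat 1) => //.
  apply: (stat_le_sub _ (@stat_le1 (words X) [::])) => -[|x w] //= /star_cons[xF _].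
  by have := stat_le0 (stat_le_mono i0 iF); rewrite -subset0 => /(_ x xF).
exists (omega_exp (omega_exp (word_exponent (f i)))); last exact: IH.
exact/omega_exp_lt/omega_exp_lt/word_exponent_mono/(@ofam_lt (osup f)).
Qed.

(** * The lower bound *)

Section ProductStature.
Variables (T1 T2 T3 : topologicalType) (phi : T1 -> T2 -> T3).

(** What the lower bound on products needs of the product topology on
    [L * M], seen through [phi]. *)
Definition separates (L : set T1) (M : set T2) : Prop := forall C D, closed C -> closed D ->
  exists2 E, closed E & forall u v, L u -> M v -> E (phi u v) <-> C u \/ D v.

Lemma separates_sub L L' M M' : L' `<=` L -> M' `<=` M -> separates L M -> separates L' M'.
Proof.
move=> LL MM sLM C D clC clD; have [E clE EP] := sLM C D clC clD.
by exists E => // u v /LL Lu /MM; apply: EP.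
Qed.

(** For a single [z], [phi] embeds the closed subsets of [L]. *)
Lemma stat_ge_slice a L z : separates L [set z] -> stat_ge a L ->
  stat_ge a [set phi u z | u in L].
Proof.
elim: a L => A f IH L sL aL i; have [C [clC LC fC]] := aL i.
have [E clE EP] := sL C set0 clC closed0.
have EPz u : L u -> E (phi u z) <-> C u.
  by move=> Lu; rewrite (EP u z Lu erefl); split=> [[]|] //; left.
exists E; split=> //.
  by move=> sE; apply: LC => u Lu; apply/EPz => //; apply: sE; exists u.
apply: stat_ge_sub (IH i (L `&` C) _ fC).
  by move=> _ [u [Lu Cu] <-]; split; [exists u|apply/EPz].
by apply: separates_sub sL => // u [].
Qed.

(** To reach [a * d + c], take closed [D] and [C] leaving statures [d] in [M] and
    [c] in [L], and the closed set of the [phi u v] with [u] in [C] or [v] in [D]: it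
    contains the product of [L] and [M `&` D], and outside of it a copy of [L `&` C]. *)
Lemma stat_ge_mul a b L M : separates L M -> stat_ge a L -> stat_ge b M ->
  stat_ge (omul a b) [set phi u v | u in L & v in M].
Proof.
elim: b M => J g IH M sLM aL bM; apply/stat_geP => x /olt_omul[j [i xji]].
have [D [clD MD gD]] := bM j.
move: (aL) => /stat_geP/(_ _ (ofam_lt i))[C [clC LC iC]].
have [E clE EP] := sLM C D clC clD.
have [z [Mz Dz]] := nonsubset MD.
have [u0 [Lu0 Cu0]] := nonsubset LC.
exists E; split=> //.
  by move=> sE; have /(EP _ _ Lu0 Mz)[] : E (phi u0 z) by apply: sE; exists u0 => //; exists z.
apply: (stat_ge_mono xji).
have [B clB BP] := sLM set0 D closed0 clD.
apply: (stat_geD clB).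
  have := IH j (M `&` D) _ aL gD; rewrite -[g j]/(@ofam (osup g) j).
  move=> H; apply: stat_ge_sub (H _) => [_ [u Lu [v [Mv Dv] <-]]|].
    split; last by apply/(BP u v Lu Mv); right.
    by split; [exists u => //; exists v|apply/(EP u v Lu Mv); right].
  by apply: separates_sub sLM => // v [].
have sz : separates (L `&` C) [set z].
  by apply: separates_sub sLM => [u []|_ ->].
apply: stat_ge_sub (stat_ge_slice sz iC) => _ [u [Lu Cu] <-].
split; last by move=> /(BP u z Lu Mz)[].
by split; [exists u => //; exists z|apply/(EP u z Lu Mz); left].
Qed.

End ProductStature.

Section LowerBound.
Variable X : topologicalType.
Implicit Types (C G Y : set X) (u v w : words X).

Lemma stat_ge_power (T : topologicalType) (phi : T -> words X -> words X) (L : set T)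
    (S : nat -> set (words X)) c :
  S 0 [::] -> (forall n, S n.+1 = [set phi u v | u in L & v in S n]) ->
  (forall n, separates phi L (S n)) -> stat_ge (omega_exp c) L ->
  forall n, stat_ge (omega_exp (omul c (onat n))) (S n).
Proof.
move=> S0 SS sep cL; elim=> [|n IH].
  apply: (@stat_ge_mono _ _ (onat 1)); last by apply: stat_ge1; exists [::].
  apply/omega_expE; split; [exact: ole_refl|].
  by move=> k; case: (ole0 (_ : ole (omul c ozero) ozero) k); apply/ole_omulP => -[].
rewrite SS; apply: stat_ge_mono (stat_ge_mul (sep n) cL IH).
apply: ole_trans (omega_exp_oadd _ _); exact/omega_exp_mono/omul_onatS_le.
Qed.

(** The words of length less than [k], for [k < n], form a chain of closed sets. *)
Lemma stat_ge_star_onat n Y : Y !=set0 -> stat_ge (onat n) (star Y).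
Proof.
move=> [x Yx]; pose S k : set (words X) := [set w | size (w : seq X) < k].
suff: stat_ge (onat n) (star Y `&` S n) by apply: stat_ge_sub => w [].
elim: n => [|n IH]; first by apply/stat_geP => b [].
have SE : S n = ~` word_open (nseq n setT).
  rewrite predeqE => w; rewrite /S /= ltnNge.
  by split=> [/negP nw /word_open_nseqT//|nw]; apply/negP => /word_open_nseqT.
apply/stat_geP => b /olt_osucc bn; exists (S n); split.
- rewrite SE; apply/open_closedC/open_word_open => U.
  by rewrite mem_nseq => /andP[_ /eqP->]; apply: openT.
- move=> sS; have : S n (nseq n x); last by rewrite /S /= size_nseq ltnn.
  apply: sS; split; first by move=> y; rewrite mem_nseq => /andP[_ /eqP->].
  by rewrite /S /= size_nseq.
apply: (stat_ge_mono bn); apply: stat_ge_sub IH => w [Yw wn].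
by do !split=> //; apply: leq_trans wn (leqnSn n).
Qed.

(** With [x] in [Y] but not in [C], the words [u1 x u2 x ... un x] with the [ui]
    over [Y `&` C] behave as an [n]-fold product: a factorization [u' y v'] with [y]
    and [n - 1] letters of [v'] outside [C] can only cut at the first [x]. *)
Lemma stat_ge_star_step c C Y : closed C -> ~ Y `<=` C ->
  stat_ge (omega_exp c) (star (Y `&` C)) ->
  forall n, stat_ge (omega_exp (omul c (onat n))) (star Y).
Proof.
move=> clC YC cY n.
have [x [Yx Cx]] := nonsubset YC.
pose L := star (Y `&` C).
pose S : nat -> set (words X) := fun k =>
  iter k (fun M => [set u ++ x :: v | u in L & v in M]) [set [::]].
pose out y := `[< (~` C) y >].
have Lout u : L u -> ~~ has out u.
  by move=> Lu; apply/hasPn => y /Lu[_ Cy]; apply/asboolP => /(_ Cy).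
have Lcount u : L u -> count out u = 0 by move=> /Lout; rewrite has_count -leqNgt leqn0 => /eqP.
have outx : out x by apply/asboolP.
have Scount k v : S k v -> count out v = k.
  elim: k v => [_ ->//|k IH _ [u Lu [v /IH vk <-]]].
  by rewrite count_cat /= Lcount // outx vk.
have SY k : S k `<=` star Y.
  elim: k => [_ ->//|k IH _ [u Lu [v /IH Yv <-]]].
  by apply/star_cat; split; [move=> y /Lu[]|apply/star_cons].
apply: (stat_ge_sub (SY n)).
apply: (@stat_ge_power _ (fun u v => u ++ x :: v) L) => // k A D clA clD.
pose W := word_open (nseq k (~` C)).
have oW : open (W : set (words X)).
  apply: open_word_open => U; rewrite mem_nseq => /andP[_ /eqP->]; exact: closed_openC.
exists (~` [set w | exists u y v, [/\ w = u ++ y :: v, (~` A) u, (~` C) y & (~` D `&` W) v]]).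
  apply: open_closedC; apply: open_lcat_letter; try exact: closed_openC.
  by apply: openI => //; apply: closed_openC.
move=> u v Lu Sv; split=> [nE|AD].
  apply: contrapT => /not_orP[Au Dv]; apply: nE; exists u, x, v; split=> //.
  by split=> //; apply/word_open_nseq; rewrite -/out (Scount k v Sv).
move=> [u' [y [v' [e Au Cy [Dv /word_open_nseq Wv]]]]].
have outy : out y by apply/asboolP.
(* [u ++ x :: v] has exactly [k.+1] letters outside [C], all of them in [y :: v']. *)
have u'0 : ~~ has out u'.
  have := congr1 (count out) e; rewrite !count_cat /= outx outy (Lcount u Lu) (Scount k v Sv).
  rewrite has_count -/out in Wv *; lia.
have es : size u = size u'.
  have := congr1 (find out) e; rewrite !find_cat (negbTE (Lout u Lu)) (negbTE u'0) /= outx outy.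
  by rewrite !addn0.
move/eqP: e; rewrite eqseq_cat // => /andP[/eqP eu /eqP[_ ev]].
by case: AD; rewrite ?eu ?ev.
Qed.

(** The words of length [n] over [Y] behave as the [n]-fold product of [Y]. *)
Lemma stat_ge_star_length c Y : stat_ge (omega_exp c) Y ->
  forall n, stat_ge (omega_exp (omul c (onat n))) (star Y).
Proof.
move=> cY n.
pose S : nat -> set (words X) := fun k =>
  iter k (fun M => [set x :: v | x in Y & v in M]) [set [::]].
have Ssize k v : S k v -> size v = k.
  by elim: k v => [_ ->//|k IH _ [x Yx [v /IH vk <-]]] /=; rewrite vk.
have SY k : S k `<=` star Y.
  by elim: k => [_ ->//|k IH _ [x Yx [v /IH Yv <-]]]; apply/star_cons.
apply: (stat_ge_sub (SY n)).
apply: (@stat_ge_power _ (fun x v => x :: v) Y) => // k A D clA clD.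
pose W := word_open (nseq k [set: X]).
have oW : open (W : set (words X)).
  apply: open_word_open => U; rewrite mem_nseq => /andP[_ /eqP->]; exact: openT.
exists (~` [set w | exists u y v,
    [/\ w = u ++ y :: v, [set: words X] u, (~` A) y & (~` D `&` W) v]]).
  apply: open_closedC; apply: open_lcat_letter; [exact: openT| |exact: closed_openC].
  by apply: openI => //; apply: closed_openC.
move=> x v Yx Sv; split=> [nE|AD].
  apply: contrapT => /not_orP[Ax Dv]; apply: nE; exists [::], x, v; split=> //.
  by split=> //; apply/word_open_nseqT; rewrite (Ssize k v Sv).
move=> [[|y u] [z [v' [e _ Az [Dv /word_open_nseqT Wv]]]]].
  by case: e AD => -> -> [].
have := congr1 size e; rewrite /= size_cat /= (Ssize k v Sv); lia.
Qed.

(** Below [omega ^ omega ^ word_exponent a], the ordinals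
    [omega ^ (omega ^ d * n)] with [d < word_exponent a] are cofinal, unless the
    exponent is 0: then words of bounded length suffice.  Such a [d] is
    handled by a proper closed subset of [Y] and separating letters, or, when [a] is
    critical and [d <= a], by words of fixed length, as then [Y] itself has stature
    at least [a = omega ^ omega ^ a]. *)
Lemma stat_ge_star a Y : olt ozero a -> stat_ge a Y ->
  stat_ge (omega_exp (omega_exp (word_exponent a))) (star Y).
Proof.
elim/olt_ind: a Y => a IH Y a0 aY.
have power d n : olt d (word_exponent a) ->
    stat_ge (omega_exp (omul (omega_exp d) (onat n))) (star Y).
  move=> da; have [[b [b0 ba db]]|[ca dla]] := word_exponent_cofinal a0 da.
    move: (aY) => /stat_geP/(_ b ba)[C [clC YC bY]].
    apply: stat_ge_mono (stat_ge_star_step clC YC (IH b ba _ b0 bY) n).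
    exact/omega_exp_mono/omul_mono/ole_refl/omega_exp_mono.
  apply: (@stat_ge_star_length (omega_exp d)); apply: stat_ge_mono aY.
  apply: ole_trans ca.2; apply: omega_exp_mono; apply: ole_trans ca.2.
  exact: omega_exp_mono.
apply/stat_geP => x xa.
suff : exists2 y, olt x y & stat_ge y (star Y) by move=> [y xy /stat_geP]; apply.
have Y0 : Y !=set0.
  move: aY => /stat_geP/(_ _ a0)[C [_ YC _]]; apply/set0P/eqP => Ye; apply: YC.
  by rewrite Ye; apply: sub0set.
have [x0|[j [n xn]]] := olt_omega_exp xa.
  exists (onat 1); first exact/olt_osucc.
  exact: stat_ge_star_onat.
have [j0|[k [m jm]]] := olt_omega_exp (ofam_lt j).
  exists (onat n.+1); last exact: stat_ge_star_onat.
  apply/olt_osucc; apply: ole_trans xn _; apply: omul_le_onat.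
  by apply: ole_trans (omega_exp_mono j0) _; apply/omega_expE; split=> [|[]]; apply: ole_refl.
exists (omega_exp (omul (omega_exp (ofam k)) (onat m.+1))); last exact/power/ofam_lt.
apply: ole_lt_trans xn _; apply: omul_onat_lt; apply: ole_lt_trans jm _.
apply: ole_lt_trans (ole_oaddr _ ozero) _.
by apply: olt_omulr; [apply: onat_lt|apply: omega_exp_gt0].
Qed.

End LowerBound.

Theorem theorem12p22 (X : topologicalType) (hX : noetherian X) :
  oeq (stature (words X))
      (if `[< oeq (stature X) ozero >] then onat 1
       else omega_exp (omega_exp (word_exponent (stature X)))).
Proof.
have leX := stature_le hX; have geX := stature_ge hX.
have starT : star [set: X] = [set: words X] by rewrite predeqE => w; split.
case: asboolP => [[X0 _]|nX0].
  have X0' (x : X) : False by have := stat_le0 (stat_le_mono X0 leX); rewrite -subset0 => /(_ x I).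
  apply: stature_eq; last by apply: stat_ge1; exists [::].
  by apply: (stat_le_sub _ (@stat_le1 (words X) [::])) => -[|x w] // _; have := X0' x.
have X0 : olt ozero (stature X).
  by have [leX0|//] := ole_or_lt (stature X) ozero; case: nX0; split=> //; apply: ozero_le.
by apply: stature_eq; rewrite -starT; [apply: stat_le_star|apply: stat_ge_star].
Qed.
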